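(* Let $\gamma$ be an $\mathbb S_{\mathrm{III}}$-plane. The set of all fixed-III-planes that meet $\gamma$ forms one system of ruling planes of a Segre variety $\mathcal S_{2;2}$ in $\mathrm{PG}(8,q)$.
   Context: Let $q>2$ be a prime power. Let $\phi$ be a collineation of $\mathrm{PG}(2,q^3)$ of order 3 fixing pointwise an $\mathbb F_q$-subplane $\mathcal P_{2,q}$. A point $\bar P$ of $\mathrm{PG}(2,q^3)$ has Type III if $\bar P,\bar P^\phi,\bar P^{\phi^2}$ are non-collinear. Bose representation: identifying $\mathbb F_{q^3}^3$ with $\mathbb F_q^9$, each point $\bar P$ corresponds to a plane $[\![P]\!]$ of $\mathrm{PG}(8,q)$; it is an $\mathbb S_{\mathrm{III}}$-plane if $\bar P$ has Type III, and its points are III-points. $\phi$ induces a projectivity $\sigma$ of $\mathrm{PG}(8,q)$ of order 3 with $[\![P]\!]^\sigma=[\![P^\phi]\!]$. A fixed-III-plane is a $\sigma$-fixed plane containing at least one III-point. $\mathcal S_{2;2}$ denotes the Segre variety of $\mathrm{PG}(2,q)\times\mathrm{PG}(2,q)$ in $\mathrm{PG}(8,q)$, which has two systems of $q^2+q+1$ ruling planes. *)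

(* Defs.v *)
From HB Require Import structures.
From mathcomp Require Import all_boot all_order all_algebra all_field.
Set Implicit Arguments.
Unset Strict Implicit.
Unset Printing Implicit Defensive.
Import GRing.Theory.
Local Open Scope ring_scope.

Definition pgpoint (F : fieldType) (V : vectType F) : Type :=
  {U : {vspace V} | \dim U == 1%N}.

Section ProjectiveSpace.
Variables (F : fieldType) (V : vectType F).
Implicit Types (P Q R X : pgpoint V) (phi : pgpoint V -> pgpoint V).

Definition collinear P Q R : Prop :=
  exists L : {vspace V},
    [/\ \dim L = 2%N, (val P <= L)%VS, (val Q <= L)%VS & (val R <= L)%VS].

Definition collineation phi : Prop :=
  bijective phi /\
  (forall L : {vspace V}, \dim L = 2%N ->
     exists2 L' : {vspace V}, \dim L' = 2%N &
       forall P, (val (phi P) <= L')%VS = (val P <= L)%VS).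

Definition typeIII phi P : Prop := ~ collinear P (phi P) (phi (phi P)).

End ProjectiveSpace.

Definition has_order (T : Type) (n : nat) (f : T -> T) : Prop :=
  [/\ (0 < n)%N, iter n f =1 id &
      forall k : nat, (0 < k < n)%N -> ~ (iter k f =1 id)].

Section Bose.
Variables (F : finFieldType) (K : fieldExtType F).

(* S is the image of the points of PG(2,K) with coordinates in F under the
   projectivity of matrix b. *)
Definition subplane (S : pgpoint 'rV[K]_3 -> Prop) : Prop :=
  exists2 b : 'M[K]_3, b \in unitmx &
    forall P : pgpoint 'rV[K]_3,
      S P <-> exists2 x : 'rV[F]_3, x != 0 &
                val P = <[map_mx (in_alg K) x *m b]>%VS.

Variable theta : 'rV[F]_9 -> 'rV[K]_3.

Definition identification : Prop :=
  bijective theta /\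
  (forall (a : F) (y z : 'rV[F]_9),
     theta (a *: y + z) = (a%:A : K) *: theta y + theta z).

Definition bose (P : pgpoint 'rV[K]_3) : {vspace 'rV[F]_9} :=
  <<enum [pred y : 'rV[F]_9 | theta y \in val P]>>%VS.

(* The spanning family is already a subspace. *)
Lemma mem_bose (P : pgpoint 'rV[K]_3) (y : 'rV[F]_9) :
  identification -> (y \in bose P) = (theta y \in val P).
Proof.
move=> [_ thetaL]; apply/idP/idP=> [/coord_span ->|Py]; last first.
  by rewrite memv_span ?mem_enum.
have theta0 : theta 0 = 0.
  have := thetaL 1 0 0; rewrite !scale1r addr0 => /eqP.
  by rewrite -subr_eq subrr eq_sym => /eqP.
elim/big_rec: _ => [|i z _ Pz]; first by rewrite theta0 mem0v.
rewrite thetaL memvD // memvZ //.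
have : (i < size (enum [pred u : 'rV[F]_9 | theta u \in val P]))%N.
  by rewrite -cardE.
by move/(mem_nth 0); rewrite mem_enum.
Qed.

Variable phi : pgpoint 'rV[K]_3 -> pgpoint 'rV[K]_3.

Definition SIII_plane (U : {vspace 'rV[F]_9}) : Prop :=
  exists2 P : pgpoint 'rV[K]_3, typeIII phi P & U = bose P.

Definition III_point (X : pgpoint 'rV[F]_9) : Prop :=
  exists2 U : {vspace 'rV[F]_9}, SIII_plane U & (val X <= U)%VS.

(* The linear bijection g represents a projectivity sigma of PG(8,F). The
   order is that of sigma acting on subspaces, so g ^+ 3 may be any scalar. *)
Definition bose_induced (g : 'End('rV[F]_9)) : Prop :=
  [/\ lker g = 0%VS,
      has_order 3 (fun U : {vspace 'rV[F]_9} => (g @: U)%VS) &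
      forall P : pgpoint 'rV[K]_3, (g @: bose P)%VS = bose (phi P)].

Definition fixed_III_plane (g : 'End('rV[F]_9)) (U : {vspace 'rV[F]_9}) :
    Prop :=
  [/\ \dim U = 3%N, (g @: U)%VS = U &
      exists2 X : pgpoint 'rV[F]_9, III_point X & (val X <= U)%VS].

End Bose.

Section Segre.
Variable F : fieldType.
Implicit Types (h : 'Hom('M[F]_3, 'rV[F]_9)) (U : {vspace 'rV[F]_9}).
Implicit Types (S : pgpoint 'rV[F]_9 -> Prop).

(* The coordinates x_i y_j of the Segre embedding of PG(2,F) x PG(2,F) form
   the matrix x^T *m y; h is a choice of coordinates of PG(8,F). *)
Definition segre_map h (x y : 'rV[F]_3) : {vspace 'rV[F]_9} :=
  <[h (x^T *m y)]>%VS.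

Definition segre_param h S : Prop :=
  lker h = 0%VS /\
  (forall X, S X <-> exists x y : 'rV[F]_3,
     [/\ x != 0, y != 0 & val X = segre_map h x y]).

Definition segre_variety S : Prop := exists h, segre_param h S.

(* The points of U are the image of {<x>} x PG(2,F). *)
Definition ruling_plane1 h U : Prop :=
  exists2 x : 'rV[F]_3, x != 0 &
    forall X : pgpoint 'rV[F]_9,
      (val X <= U)%VS <-> exists2 y, y != 0 & val X = segre_map h x y.

(* The points of U are the image of PG(2,F) x {<y>}. *)
Definition ruling_plane2 h U : Prop :=
  exists2 y : 'rV[F]_3, y != 0 &
    forall X : pgpoint 'rV[F]_9,
      (val X <= U)%VS <-> exists2 x, x != 0 & val X = segre_map h x y.

Definition ruling_system S (Sys : {vspace 'rV[F]_9} -> Prop) : Prop :=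
  exists2 h, segre_param h S &
    (forall U, Sys U <-> ruling_plane1 h U) \/
    (forall U, Sys U <-> ruling_plane2 h U).

End Segre.

(* Main.v *)
(** Let [gamma] be the Bose plane of the Type III point [P].  The three planes
    [gamma], [sigma gamma], [sigma^2 gamma] are the Bose planes of [P], [phi P],
    [phi (phi P)], which are independent over [K]; hence
    [F^9 = gamma (+) sigma gamma (+) sigma^2 gamma], and
    [w (x) y |-> y_0 w + y_1 sigma w + y_2 sigma^2 w] is a linear isomorphism
    from [gamma (x) F^3] onto [F^9].  A [sigma]-fixed plane meeting [gamma] in
    [<w>] contains the independent vectors [w], [sigma w], [sigma^2 w], so it is
    their span, i.e. the image of [w (x) F^3].  Conversely such a span is
    [sigma]-fixed because [sigma^3] fixes every point. *)
Require Import Defs.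
From HB Require Import structures.
From mathcomp Require Import all_boot all_order all_algebra all_field.
Set Implicit Arguments.
Unset Strict Implicit.
Unset Printing Implicit Defensive.
Import GRing.Theory.
Local Open Scope ring_scope.

Lemma lfun_of_linear (F : fieldType) (U V : vectType F) (f : U -> V) :
  linear f -> exists g : 'Hom(U, V), g =1 f.
Proof.
move=> fl.
pose fL : {linear U -> V} := HB.pack f (GRing.isLinear.Build _ _ _ _ f fl).
by exists (linfun fL) => u; rewrite lfunE.
Qed.

Section Subspaces.
Variables (F : fieldType) (V : vectType F).
Implicit Types U : {vspace V}.

Lemma subv_pgpointP U U' :
  (forall X : pgpoint V, (val X <= U)%VS -> (val X <= U')%VS) -> (U <= U')%VS.
Proof.
move=> sUU'; apply/subvP => u Uu.
have [->|u0] := eqVneq u 0; first exact: mem0v.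
have dX : \dim <[u]>%VS == 1%N by rewrite dim_vline u0.
by have := sUU' (exist _ <[u]>%VS dX); rewrite /= -!memvE; apply.
Qed.

(** Ruling planes are specified through their points; this gives the points of [limg f] in that
    form. *)
Lemma pgpoint_limg (n : nat) (f : 'Hom('rV[F]_n, V)) (X : pgpoint V) :
  lker f = 0%VS ->
  (val X <= limg f)%VS <-> exists2 y, y != 0 & val X = <[f y]>%VS.
Proof.
move=> kf; split=> [sXf | [y _ ->]]; last by rewrite -memvE memv_img ?memvf.
have dX := eqP (valP X).
have Xu : vpick (val X) \in val X := memv_pick _.
have u0 : vpick (val X) != 0 by rewrite vpick0 -dimv_eq0 dX.
have /memv_imgP[y _ uE] := subvP sXf _ Xu.
exists y; first by apply: contra_neq u0 => y0; rewrite uE y0 linear0.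
by apply/eqP; rewrite eq_sym eqEdim dX dim_vline -uE u0 -memvE Xu.
Qed.

(** Needed because [collinear] asks for a subspace of dimension exactly 2, while coinciding points
    span only dimension 1. *)
Lemma exists_dim2_supspace U : (0 < \dim U <= 2)%N -> (2 <= \dim {:V})%N ->
  exists2 L : {vspace V}, \dim L = 2%N & (U <= L)%VS.
Proof.
move=> /andP[U0 U2] V2; have [d2|] := eqVneq (\dim U) 2%N; first by exists U.
move=> n2; have d1 : \dim U = 1%N by move: (\dim U) U0 U2 n2 => [|[|[|]]].
have c0 : (U^C)%VS != 0%VS.
  by rewrite -dimv_eq0 dimv_compl d1 subn_eq0 -ltnNge.
exists (U + <[vpick U^C]>)%VS; last exact: addvSl.
rewrite dimv_disjoint_sum ?dim_vline ?vpick0 ?c0 ?d1 //.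
apply/eqP; rewrite -subv0 -(capv_compl U) capvS //.
by rewrite -memvE memv_pick.
Qed.

Lemma coordinates_of_subspace U (n : nat) : \dim U = n ->
  exists2 W : 'Hom('rV[F]_n, V), lker W = 0%VS & limg W = U.
Proof.
move=> dU.
have e := vbasisP U; move: (vbasis U) e; rewrite dU => b bU.
have [|W WE] := @lfun_of_linear F 'rV[F]_n V (fun x => \sum_i x 0 i *: b`_i).
  move=> a u v; rewrite scaler_sumr -big_split; apply: eq_bigr => i _ /=.
  by rewrite !mxE scalerDl scalerA.
exists W.
  apply/eqP/lker0P => u v; rewrite !WE => /eqP.
  rewrite -subr_eq0 -sumrB => /eqP.
  under eq_bigr do rewrite -scalerBl.
  move=> uv; apply/rowP => i; apply/eqP; rewrite -subr_eq0; apply/eqP.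
  have /freeP fb := basis_free bU.
  exact: (fb (fun i => u 0 i - v 0 i)) i.
apply/eqP; rewrite eqEsubv; apply/andP; split; apply/subvP => u.
  move=> /memv_imgP[x _ ->]; rewrite WE memv_suml // => i _.
  by rewrite memvZ // (basis_mem bU) // mem_nth ?size_tuple.
move=> Uu; rewrite (coord_basis bU Uu).
have -> : \sum_i coord b i u *: b`_i = W (\row_i coord b i u).
  by rewrite WE; apply: eq_bigr => i _; rewrite mxE.
by rewrite memv_img ?memvf.
Qed.

(** Three points not on a line span dimension at least 3, the sum of their dimensions, so their sum
    is direct. *)
Lemma noncollinear_independent (P Q R : pgpoint V) (a b c : V) :
  (2 <= \dim {:V})%N -> ~ collinear P Q R ->
  a \in val P -> b \in val Q -> c \in val R -> a + b + c = 0 ->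
  [/\ a = 0, b = 0 & c = 0].
Proof.
move=> V2 ncol Pa Qb Rc abc0.
pose U := (val P + val Q + val R)%VS.
have dP := eqP (valP P); have dQ := eqP (valP Q); have dR := eqP (valP R).
have sPU : (val P <= U)%VS by rewrite /U -addvA addvSl.
have sQU : (val Q <= U)%VS by rewrite /U (addvC (val P)) -addvA addvSl.
have sRU : (val R <= U)%VS by rewrite addvSr.
have dU : (2 < \dim U)%N.
  rewrite ltnNge; apply/negP => U2; apply: ncol.
  have [|//|L dL sUL] := @exists_dim2_supspace U.
    by rewrite U2 andbT -dP dimvS.
  by exists L; split=> //; apply: subv_trans sUL.
have dPQ : (\dim (val P + val Q)%VS <= 2)%N.
  by rewrite (leq_trans (dimv_add_leqif _ _)) // dP dQ.
(* The dimension formula gives [\dim U] plus the dimension of the intersection as at most 2 + 1, and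
   [\dim U] is already at least 3. *)
have PQR0 : ((val P + val Q) :&: val R = 0)%VS.
  apply/eqP; rewrite -dimv_eq0 -leqn0 -(leq_add2l (\dim U)) dimv_sum_cap dR.
  rewrite addn0.
  by apply: leq_trans dU; rewrite addn1 ltnS.
have PQ0 : (val P :&: val Q = 0)%VS.
  apply/eqP; rewrite -dimv_eq0 -leqn0 -(leq_add2l (\dim (val P + val Q)%VS)).
  rewrite dimv_sum_cap dP dQ addn0.
  rewrite -ltnS (leq_trans dU) // (leq_trans (dimv_add_leqif _ _)) //.
  by rewrite dR addn1.
have c0 : c = 0.
  apply/eqP; rewrite -memv0 -PQR0 memv_cap Rc andbT.
  by rewrite -(addr0_eq abc0) memvN memv_add.
move: abc0; rewrite c0 addr0 => ab0.
have b0 : b = 0.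
  apply/eqP; rewrite -memv0 -PQ0 memv_cap Qb andbT.
  by rewrite -(addr0_eq ab0) memvN.
by move: ab0; rewrite b0 addr0 => ->.
Qed.

End Subspaces.

Section BosePlane.
Variables (F : finFieldType) (K : fieldExtType F).
Variables (theta : 'rV[F]_9 -> 'rV[K]_3) (htheta : identification theta).

Lemma identificationD y z : theta (y + z) = theta y + theta z.
Proof. by have := htheta.2 1 y z; rewrite !scale1r. Qed.

Lemma identification0 : theta 0 = 0.
Proof. by apply: (addrI (theta 0)); rewrite -identificationD !addr0. Qed.

(** If [v] spans [P] over [K], then [k |-> ti (k *: v)], with [ti] inverse to [theta], is an
    [F]-linear isomorphism from [K] onto the Bose subspace. *)
Lemma dim_bose (P : pgpoint 'rV[K]_3) : \dim (bose theta P) = \dim {:K}.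
Proof.
have [ti tiK tK] := htheta.1.
have dP := eqP (valP P); pose v := vpick (val P).
have v0 : v != 0 by rewrite vpick0 -dimv_eq0 dP.
have PE : val P = <[v]>%VS.
  by apply/eqP; rewrite eq_sym eqEdim dP dim_vline v0 -memvE memv_pick.
have [|f fE] := @lfun_of_linear F K 'rV[F]_9 (fun k => ti (k *: v)).
  move=> a k l; apply: (can_inj tiK); rewrite htheta.2 !tK scalerA -scalerDl.
  by rewrite mulr_algl.
have kf : lker f == 0%VS.
  apply/lker0P => k l; rewrite !fE => /(can_inj tK)/eqP.
  by rewrite -subr_eq0 -scalerBl scaler_eq0 (negPf v0) orbF subr_eq0 => /eqP.
rewrite -(limg_dim_eq (f := f)) ?(eqP kf) ?capv0 //; congr (\dim _).
apply/vspaceP => y; rewrite mem_bose // PE; apply/vlineP/memv_imgP.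
  by move=> [k yE]; exists k; rewrite ?memvf // fE -yE tiK.
by move=> [k _ ->]; exists k; rewrite fE tK.
Qed.

(** Independence in ['rV[K]_3] transfers back because [theta] is additive and injective. *)
Lemma bose_independent (P Q R : pgpoint 'rV[K]_3) (a b c : 'rV[F]_9) :
  ~ collinear P Q R ->
  a \in bose theta P -> b \in bose theta Q -> c \in bose theta R ->
  a + b + c = 0 -> [/\ a = 0, b = 0 & c = 0].
Proof.
rewrite !mem_bose // => ncol Pa Qb Rc abc.
have ti := bij_inj htheta.1.
have V2 : (2 <= \dim {:'rV[K]_3})%N by rewrite dimvf /dim /=.
have [|a0 b0 c0] := noncollinear_independent V2 ncol Pa Qb Rc.
  by rewrite -!identificationD abc identification0.
by split; apply: ti; rewrite identification0.
Qed.

End BosePlane.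

Section SegreFromEndomorphism.
Variables (F : fieldType) (V : vectType F) (g : 'End(V)).
Variable W : 'Hom('rV[F]_3, V).
Hypothesis W0 : lker W = 0%VS.
Hypothesis gW_free : forall x y z,
  W x + g (W y) + g (g (W z)) = 0 -> [/\ W x = 0, W y = 0 & W z = 0].

(** The map sends each column of a matrix through [W], applies [g] as often as the column index, and
    adds up; [gW_free] makes it injective. Column [j] of [x^T *m y] is [y 0 j *: x]. *)
Lemma exists_segre_hom : exists2 h : 'Hom('M[F]_3, V), lker h = 0%VS &
  forall x y : 'rV[F]_3, h (x^T *m y) =
    y 0 0 *: W x + y 0 1 *: g (W x) + y 0 2 *: g (g (W x)).
Proof.
pose f (M : 'M[F]_3) :=
  W (row 0 M^T) + g (W (row 1 M^T)) + g (g (W (row 2 M^T))).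
have [|h hE] := @lfun_of_linear F 'M[F]_3 V f.
  move=> a M N.
  have rP j : row j (a *: M + N)^T = a *: row j M^T + row j N^T.
    by apply/rowP => i; rewrite !mxE.
  rewrite /f !rP !linearP !scalerDr.
  by rewrite (addrACA (a *: W _)) (addrACA (a *: W _ + _)).
exists h.
  apply/eqP; rewrite -subv0; apply/subvP => M; rewrite memv_ker hE memv0.
  move=> /eqP/gW_free[r0 r1 r2].
  have Winj x : W x = 0 -> x = 0.
    by move=> /eqP; rewrite -memv_ker W0 memv0 => /eqP.
  apply/eqP/matrixP => i j; rewrite [RHS]mxE.
  move: r0 r1 r2 => /Winj/rowP/(_ i) + /Winj/rowP/(_ i) + /Winj/rowP/(_ i).
  rewrite !mxE; case: j => [[|[|[|//]]] lt_j] e0 e1 e2.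
  - by rewrite -[RHS]e0; congr (M _ _); apply: val_inj.
  - by rewrite -[RHS]e1; congr (M _ _); apply: val_inj.
  - by rewrite -[RHS]e2; congr (M _ _); apply: val_inj.
move=> x y; rewrite hE /f.
have rE j : row j (x^T *m y)^T = y 0 j *: x.
  by apply/rowP => i; rewrite !mxE big_ord1 !mxE mulrC.
by rewrite !rE !linearZ.
Qed.

End SegreFromEndomorphism.

Lemma trmx_mul_eq0 (F : fieldType) (m n : nat) (x : 'rV[F]_m) (y : 'rV[F]_n) :
  x != 0 -> x^T *m y = 0 -> y = 0.
Proof.
move=> /rV0Pn[i xi0] xy0; apply/rowP => j; apply/eqP.
move/matrixP/(_ i j)/eqP: xy0; rewrite !mxE big_ord1 !mxE mulf_eq0.
by rewrite (negPf xi0).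
Qed.

Theorem theorem21 (F : finFieldType) (K : fieldExtType F)
  (hq : (2 < #|F|)%N) (hK : \dim {:K} = 3%N)
  (phi : pgpoint 'rV[K]_3 -> pgpoint 'rV[K]_3)
  (hphi : collineation phi) (hphi3 : has_order 3 phi)
  (P2q : pgpoint 'rV[K]_3 -> Prop) (hP2q : subplane P2q)
  (hfix : forall P : pgpoint 'rV[K]_3, P2q P -> phi P = P)
  (theta : 'rV[F]_9 -> 'rV[K]_3) (htheta : identification theta)
  (sigma : 'End('rV[F]_9)) (hsigma : bose_induced theta phi sigma)
  (gamma : {vspace 'rV[F]_9}) (hgamma : SIII_plane theta phi gamma) :
  exists2 S : pgpoint 'rV[F]_9 -> Prop, segre_variety S &
    ruling_system S (fun U : {vspace 'rV[F]_9} =>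
      fixed_III_plane theta phi sigma U /\ (U :&: gamma)%VS <> 0%VS).
Proof.
have [P PIII gammaE] := hgamma; have [ks [_ s3 _] sE] := hsigma.
have dgamma : \dim gamma = 3%N by rewrite gammaE dim_bose.
have [W kW imW] := coordinates_of_subspace dgamma.
have Wgamma x : W x \in gamma by rewrite -imW memv_img ?memvf.
have s_inj u : sigma u = 0 -> u = 0.
  by move=> /eqP; rewrite -memv_ker ks memv0 => /eqP.
(* The three summands lie in the Bose planes of [P], [phi P] and [phi (phi P)], which are
   independent since [P] has Type III. *)
have [|h kh hE] := exists_segre_hom (g := sigma) kW.
  move=> x y z xyz.
  have [|||Wx0 /s_inj Wy0 /s_inj/s_inj Wz0 //] :=
    bose_independent htheta PIII _ _ _ xyz.
  - by rewrite -gammaE.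
  - by rewrite -sE memv_img // -gammaE.
  - by rewrite -!sE !memv_img // -gammaE.
(* For fixed nonzero [x], [limg E] is the ruling plane through the point [<[W x]>] of [gamma]. *)
have Rx x : exists2 E : 'Hom('rV[F]_3, 'rV[F]_9),
    x != 0 -> lker E = 0%VS & forall y, E y = h (x^T *m y).
  have [|E EE] := @lfun_of_linear F 'rV[F]_3 'rV[F]_9 (fun y => h (x^T *m y)).
    by move=> a y z; rewrite mulmxDr -scalemxAr linearP.
  exists E => // x0; apply/eqP; rewrite -subv0; apply/subvP => y.
  rewrite memv_ker EE -memv_ker kh !memv0 => /eqP xy0.
  by rewrite (trmx_mul_eq0 x0 xy0).
have dE (E : 'Hom('rV[F]_3, 'rV[F]_9)) : lker E = 0%VS -> \dim (limg E) = 3%N.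
  by move=> kE; rewrite limg_dim_eq ?kE ?capv0 // dimvf.
exists (fun X => exists x y : 'rV[F]_3,
          [/\ x != 0, y != 0 & val X = segre_map h x y]).
  by exists h; split.
exists h; first by split.
(* The first factor of the Segre product parametrises the points of [gamma], so the first system is
   the one sought. *)
left=> U; split.
  move=> [[dU sU _] /eqP Ugamma].
  have u0 : vpick (U :&: gamma)%VS != 0 by rewrite vpick0.
  have := memv_pick (U :&: gamma)%VS; move: (vpick _) u0 => u u0.
  rewrite memv_cap -imW => /andP[Uu /memv_imgP[x _ uE]].
  rewrite {u}uE in u0 Uu.
  have x0 : x != 0 by apply: contra_neq u0 => ->; rewrite linear0.
  exists x => // X; have [E /(_ x0) kE EE] := Rx x.
  (* [U] is [sigma]-invariant and contains [W x], hence contains [limg E]; both have dimension 3. *)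
  have -> : U = limg E.
    apply/eqP; rewrite eq_sym eqEdim dU dE // andbT.
    apply/subvP => _ /memv_imgP[y _ ->].
    have sUU u : u \in U -> sigma u \in U.
      by rewrite -{2}sU => /(memv_img sigma).
    by rewrite EE hE !memvD ?memvZ ?sUU.
  split=> [/(pgpoint_limg X kE)[y y0 XE] | [y y0 XE]].
    by exists y; rewrite // XE EE.
  by apply/(pgpoint_limg X kE); exists y; rewrite // XE EE.
move=> [x x0 UX]; have [E /(_ x0) kE EE] := Rx x.
(* The two subspaces have the same points. *)
have UE : U = limg E.
  apply/eqP; rewrite eqEsubv; apply/andP; split; apply: subv_pgpointP => X.
    move=> /UX[y y0 XE]; apply/(pgpoint_limg X kE).
    by exists y; rewrite // XE EE.
  move=> /(pgpoint_limg X kE)[y y0 XE]; apply/UX.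
  by exists y; rewrite // XE EE.
have Ey a b c : a *: W x + b *: sigma (W x) + c *: sigma (sigma (W x)) \in U.
  rewrite UE; apply/memv_imgP.
  by exists (\row_j [:: a; b; c]`_j); rewrite ?memvf // EE hE !mxE.
have Ux : W x \in U by have := Ey 1 0 0; rewrite scale1r !scale0r !addr0.
have Wx0 : W x != 0 by rewrite -memv_ker kW memv0.
have dU : \dim U = 3%N by rewrite UE dE.
(* Order 3 is that of the projectivity: the cube of [sigma] fixes the point [<[W x]>], but may scale
   its vectors. *)
have [c s3x] : exists c, sigma (sigma (sigma (W x))) = c *: W x.
  apply/vlineP; have /= <- := s3 <[W x]>%VS.
  by rewrite !limg_line memv_line.
have dX : \dim <[W x]>%VS == 1%N by rewrite dim_vline Wx0.
split; last first.
  by move=> U0; move: Wx0; rewrite -memv0 -U0 memv_cap Ux Wgamma.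
split=> //; last first.
  (* The required III-point is [<[W x]>], which lies in the Type III plane [gamma] itself. *)
  exists (exist _ <[W x]>%VS dX); last by rewrite -memvE.
  by exists gamma; rewrite //= -memvE.
(* As [sigma] is injective, it is enough that it maps [U] into [U]. *)
apply/eqP; rewrite eqEdim limg_dim_eq ?ks ?capv0 // leqnn andbT.
apply/subvP => _ /memv_imgP[u Uu ->].
move: Uu; rewrite {1}UE => /memv_imgP[y _ ->]; rewrite EE hE.
(* Applying [sigma] shifts the three coefficients cyclically, the last one returning to [W x]
   multiplied by [c]. *)
by rewrite !linearD !linearZ /= s3x scalerA addrC addrA Ey.
Qed.
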